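(* There is an absolute constant $c_5>0$ such that the following holds. For all large enough $n$ and all $k$ with $c_5\log n<k\le \frac n4$, any algorithm (read-once branching program) that distinguishes random sparse parities of sparsity $k$ on $n$ variables from satisfiable ones, i.e. distinguishes between the distribution $D_0$ and the distribution $D_1(x)$ for an unknown $x$ chosen uniformly at random from $\{0,1\}^n$, with success probability at least $\frac12+2^{-o(k)}$, requires either memory of size $\Omega(nk)$ or $2^{\Omega(k)}$ samples.
   Context: $D_0$ is the distribution on vectors $(v^1,\dots,v^n,b)\in\{0,1\}^{n+1}$ where each $v^i$ independently equals $1$ with probability $k/n$ and $0$ otherwise, and $b$ is an independent uniform bit. For $x\in\{0,1\}^n$, $D_1(x)$ is the distribution on $(v^1,\dots,v^n,b)\in\{0,1\}^{n+1}$ where each $v^i$ independently equals $1$ with probability $k/n$, and $b=\langle v,x\rangle=\sum_i v^ix^i \bmod 2$ with $v=(v^1,\dots,v^n)$. A branching program for a distinguishing problem of length $m$ and width $d$ is a directed multigraph with vertices in $m+1$ layers, each containing at most $d$ vertices; layer 0 has a single start vertex; each non-leaf vertex has one outgoing edge for each possible sample value, going to the next layer; all vertices in the last layer are leaves, each labeled with an output bit in $\{0,1\}$. On samples $u_1,\dots,u_m$ the program follows the labeled edges from the start vertex and outputs the label of the leaf reached. Memory $b$ corresponds to width $2^b$; the number of samples is the length $m$. The success probability of a distinguisher $L$ is $$\frac{\Pr_{u_1,\dots,u_m\sim D_0}[L(u_1,\dots,u_m)=0]+\Pr_{x\in_R\{0,1\}^n;\,u_1,\dots,u_m\sim D_1(x)}[L(u_1,\dots,u_m)=1]}{2},$$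 with samples drawn independently. *)

(* Defs.v *)
From HB Require Import structures.
From mathcomp Require Import all_boot all_order all_algebra.
From mathcomp Require Import all_classical all_reals all_analysis.
Set Implicit Arguments.
Unset Strict Implicit.
Unset Printing Implicit Defensive.
Import Order.TTheory GRing.Theory Num.Theory numFieldNormedType.Exports.
Local Open Scope ring_scope.

(* [out v = inl b] makes v a leaf labelled b; [out v = inr e] gives v one edge,
   to [e a], for each sample value a.  Layers before the last may contain
   leaves too. *)
Record branching_program (S : finType) (m d : nat) := BranchingProgram {
  vertex : finType;
  layer : vertex -> 'I_m.+1;
  start : vertex;
  out : vertex -> bool + (S -> vertex);
  layer0P : forall v, layer v = ord0 <-> v = start;
  widthP : forall i : 'I_m.+1, (#|[set v | layer v == i]| <= d)%N;
  edgeP : forall v e a, out v = inr e -> layer (e a) = (layer v).+1 :> nat;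
  last_leafP : forall v, layer v = ord_max -> exists b, out v = inl b
}.

(* The value [false] at a non-leaf with no sample left is never reached from
   the start vertex on m samples, since [last_leafP] makes layer m all leaves. *)
Fixpoint bp_run (S : finType) (m d : nat) (B : branching_program S m d)
    (v : vertex B) (us : seq S) : bool :=
  match out v, us with
  | inl b, _ => b
  | inr e, a :: us' => bp_run (e a) us'
  | inr _, [::] => false
  end.

Definition bp_output (S : finType) (m d : nat) (B : branching_program S m d)
  (u : m.-tuple S) : bool := bp_run (start B) u.

Definition bitvec (n : nat) : finType := {ffun 'I_n -> bool}.

Definition sample (n : nat) : finType := (bitvec n * bool)%type.

Definition inner2 (n : nat) (v x : bitvec n) : bool :=
  odd (\sum_(i < n) (v i && x i))%N.

Section Distributions.
Variable R : realType.

Definition sparse_pmf (n k : nat) (v : bitvec n) : R :=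
  \prod_(i < n) bernoulli_pmf (k%:R / n%:R) (v i).

Definition D0 (n k : nat) (s : sample n) : R := sparse_pmf k s.1 / 2.

Definition D1 (n k : nat) (x : bitvec n) (s : sample n) : R :=
  sparse_pmf k s.1 * (s.2 == inner2 s.1 x)%:R.

(* Probability that L outputs b on m independent samples with probability
   mass function D. *)
Definition pr_output (S : finType) (m : nat) (D : S -> R)
    (L : m.-tuple S -> bool) (b : bool) : R :=
  \sum_(u : m.-tuple S | L u == b) \prod_(i < m) D (tnth u i).

Definition success (n k m : nat) (L : m.-tuple (sample n) -> bool) : R :=
  (pr_output (@D0 n k) L false
   + (\sum_(x : bitvec n) pr_output (D1 k x) L true) / #|bitvec n|%:R) / 2.

Definition log2 (x : R) : R := ln x / ln 2.

End Distributions.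

(* Main.v *)
Require Import Defs.
From mathcomp Require Import all_boot all_order all_algebra.
From mathcomp Require Import all_classical all_reals all_analysis.
From mathcomp Require Import ring lra.
Import Order.TTheory GRing.Theory Num.Theory numFieldNormedType.Exports.
Set Implicit Arguments.
Unset Strict Implicit.
Unset Printing Implicit Defensive.
Local Open Scope classical_set_scope.
Local Open Scope ring_scope.

(** For a vertex v, let q(v) be its D_0-probability and phi_v(x) the likelihood
    ratio of reaching v under D_1(x) against D_0.  The average E_x phi_v is then
    the ratio of the probabilities of v in the two experiments, so it suffices to
    bound the chi-square distance sum_v q(v) (E phi_v - 1)^2.

    Reading a sample (a, b) multiplies phi by 1 + b chi_a (b = 1 or -1).  For h >= 0
    with sup h <= e^{3n/64}, the mean square of E(h chi_a) over sparse a is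
    E_{x,y} h(x) h(y) (1 - 2k/n)^{|x+y|}, at most e^{-k/4} (1 + E h)^2: far pairs
    have a small kernel and close pairs are exponentially rare.  Hence, as long as
    phi <= B = e^{n/64}, for every g <= B^2 of mean 1 the potential
    sum_v q(v) (1 + E(phi_v g))^K with K about k/16 hardly grows with time:
    merging vertices decreases it by convexity, and its second-order growth is
    governed by the bound above.

    To keep phi <= B, phi is set to 0 wherever it exceeds B.  If the set S of such
    x has density at most B^-2, little mass is lost; otherwise the potential with
    g = 1_S / density(S) gives q(v) B^K <= O(2^K), so v has probability about
    2^{-Omega(nk)} and a union bound over the vertices controls the loss.  The
    potential with K = 2 and g = 1 then bounds the chi-square distance. *)

(** * Power inequalities *)

Section PowerInequalities.
Variable R : realFieldType.

(** Convexity of the power function. In the induction, multiplying the bound by [y] leaves the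
    surplus [K.+1 * c ^+ K * (y - c) ^+ 2]. *)
Lemma pow_tangent (c y : R) (K : nat) : 0 <= c -> 0 <= y ->
  c ^+ K + K%:R * c ^+ K.-1 * (y - c) <= y ^+ K.
Proof.
move=> c0 y0; elim: K => [|[|K] IH]; first by rewrite !expr0 !mul0r addr0.
  by rewrite /= !expr1 expr0 mulr1 mul1r [leLHS]addrC subrK.
have h : 0 <= y * (y ^+ K.+1 - (c ^+ K.+1 + K.+1%:R * c ^+ K * (y - c))).
  by rewrite mulr_ge0 ?subr_ge0.
have h2 : 0 <= K.+1%:R * c ^+ K * (y - c) ^+ 2.
  apply: mulr_ge0; last exact: sqr_ge0.
  by apply: mulr_ge0; [exact: ler0n | exact: exprn_ge0].
rewrite -subr_ge0; apply: (le_trans (addr_ge0 h h2)).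
rewrite le_eqVlt; apply/orP; left; apply/eqP.
by rewrite /= -[K.+2%:R]natr1 !exprS; ring.
Qed.

(** The linear coefficient is exact, since that term will average to zero; the crude [3 ^+ K] is
    affordable because it only meets the tiny [lam]. *)
Lemma pow_quadratic_ub (u : R) (K : nat) : -1 <= u <= 1 ->
  (1 + u) ^+ K <= 1 + K%:R * u + 3 ^+ K * u ^+ 2.
Proof.
move=> /andP[u1 u2]; elim: K => [|K IH].
  by rewrite !expr0 mul0r addr0 mul1r lerDl sqr_ge0.
have u20 : 0 <= u ^+ 2 by exact: sqr_ge0.
have K3 : K%:R <= 3 ^+ K :> R by rewrite -natrX ler_nat ltnW // ltn_expl.
have T0 : 0 <= (3 : R) ^+ K by exact: exprn_ge0.
have u1' : 0 <= 1 + u by lra.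
rewrite exprS; apply: (le_trans (ler_wpM2l u1' IH)).
rewrite (exprS 3) -[K.+1%:R]natr1 -subr_ge0.
have -> : 1 + (K%:R + 1) * u + 3 * 3 ^+ K * u ^+ 2 -
  (1 + u) * (1 + K%:R * u + 3 ^+ K * u ^+ 2)
  = u ^+ 2 * ((3 ^+ K - K%:R) + 3 ^+ K * (1 - u)) by ring.
by rewrite mulr_ge0 // addr_ge0 ?mulr_ge0 ?subr_ge0.
Qed.

Lemma jensen_pow (I : finType) (P : pred I) (w y : I -> R) (K : nat) :
  (forall i, 0 <= w i) -> (forall i, 0 <= y i) ->
  (\sum_(i | P i) w i)
      * (1 + (\sum_(i | P i) w i * y i) / (\sum_(i | P i) w i)) ^+ K
    <= \sum_(i | P i) w i * (1 + y i) ^+ K.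
Proof.
move=> w0 y0; set Q := \sum_(i | P i) w i.
have Q0 : 0 <= Q by exact: sumr_ge0.
have [->|Qn0] := eqVneq Q 0.
  rewrite mul0r sumr_ge0 // => i _.
  by rewrite mulr_ge0 // exprn_ge0 // addr_ge0.
(* [d] is the weighted mean of [1 + y]; for the tangent at [d] the linear terms cancel, as
   [Q + c - Q * d = 0]. *)
set c := (X in X / Q); set d := 1 + c / Q.
have c0 : 0 <= c by apply: sumr_ge0 => i _; rewrite mulr_ge0.
have d0 : 0 <= d by rewrite addr_ge0 // divr_ge0.
apply: (@le_trans _ _
  (\sum_(i | P i) w i * (d ^+ K + K%:R * d ^+ K.-1 * ((1 + y i) - d)))).
  rewrite le_eqVlt; apply/orP; left; apply/eqP.
  transitivity (Q * d ^+ K + K%:R * d ^+ K.-1 * (Q + c - Q * d)).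
    by rewrite /d; field.
  rewrite /c /Q !(mulr_suml, mulr_sumr) -!(sumrB, big_split) /= mulr_sumr.
  rewrite -big_split /=; apply: eq_bigr => i _; ring.
apply: ler_sum => i _; apply: ler_wpM2l => //.
by apply: pow_tangent => //; rewrite addr_ge0.
Qed.

End PowerInequalities.

(** * State distribution of an automaton reading independent samples *)

Section Occupancy.
Variables (R : realFieldType) (S V : finType) (step : V -> S -> V) (v0 : V).

Fixpoint occupancy (D : S -> R) (t : nat) (v : V) : R :=
  if t is t'.+1 then
    \sum_(p : V * S | step p.1 p.2 == v) occupancy D t' p.1 * D p.2
  else (v == v0)%:R.

Lemma occupancy_ge0 (D : S -> R) t v :
  (forall s, 0 <= D s) -> 0 <= occupancy D t v.
Proof.
move=> D0; elim: t v => [|t IH] v /=; first exact: ler0n.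
by apply: sumr_ge0 => p _; rewrite mulr_ge0.
Qed.

(** Duality: pushing the distribution one step forward amounts to averaging the observable [h] over
    the next sample. *)
Lemma sum_occupancyS (D : S -> R) t (h : V -> R) :
  \sum_v occupancy D t.+1 v * h v
  = \sum_v occupancy D t v * \sum_s D s * h (step v s).
Proof.
transitivity (\sum_v \sum_(p : V * S | step p.1 p.2 == v)
    occupancy D t p.1 * D p.2 * h (step p.1 p.2)).
  apply: eq_bigr => v _; rewrite /= mulr_suml.
  by apply: eq_bigr => p /eqP->.
transitivity (\sum_(p : V * S) occupancy D t p.1 * D p.2 * h (step p.1 p.2)).
  by rewrite [RHS](partition_big (fun p : V * S => step p.1 p.2) predT).
rewrite -(pair_big predT predT
  (fun v s => occupancy D t v * D s * h (step v s))) /=.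
by apply: eq_bigr => v _; rewrite mulr_sumr; apply: eq_bigr => s _; rewrite mulrA.
Qed.

Lemma sum_occupancy (D : S -> R) t :
  \sum_s D s = 1 -> \sum_v occupancy D t v = 1.
Proof.
move=> D1; elim: t => [|t IH].
  rewrite (bigD1 v0) //= eqxx big1 ?addr0 // => v /negbTE->.
  by rewrite mulr0n.
transitivity (\sum_v occupancy D t.+1 v * (fun=> 1) v).
  by apply: eq_bigr => v _; rewrite mulr1.
rewrite sum_occupancyS -[RHS]IH; apply: eq_bigr => v _.
rewrite -[RHS]mulr1 -[in RHS]D1; congr (_ * _).
by apply: eq_bigr => s _; rewrite mulr1.
Qed.

End Occupancy.

Lemma sum_tupleS (R : realFieldType) (S : finType) m (g : seq S -> R) :
  \sum_(u : m.+1.-tuple S) g u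
  = \sum_s \sum_(u : m.-tuple S) g (s :: u).
Proof.
rewrite (pair_big predT predT (fun s (u : m.-tuple S) => g (s :: u))) /=.
rewrite (reindex (fun p : S * m.-tuple S => [tuple of p.1 :: p.2])) //=.
exists (fun u => (thead u, [tuple of behead u])) => [[s u] _|u _] /=.
  by congr pair; apply: val_inj.
by rewrite -tuple_eta.
Qed.

(** Both sides equal the m-fold averaging operator applied to [h] at [v0]: the tuple sum peels off
    the first sample, the occupancy the last one. *)
Lemma sum_run_occupancy (R : realFieldType) (S V : finType) (step : V -> S -> V)
    (D : S -> R) m (v0 : V) (h : V -> R) :
  \sum_(u : m.-tuple S) (\prod_(s <- u) D s) * h (foldl step v0 u)
  = \sum_v occupancy step v0 D m v * h v.
Proof.
transitivity (iter m (fun h v => \sum_s D s * h (step v s)) h v0).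
  elim: m v0 => [|m IH] v0.
    rewrite (big_pred1 [tuple]) => [|u]; last exact/esym/eqP/tuple0.
    by rewrite big_nil mul1r.
  rewrite (@sum_tupleS _ _ _ (fun u => (\prod_(s <- u) D s) * h (foldl step v0 u))).
  rewrite iterS; apply: eq_bigr => s _; rewrite -IH mulr_sumr.
  by apply: eq_bigr => u _; rewrite big_cons mulrA.
elim: m h => [|m IH] h.
  rewrite (bigD1 v0) //= eqxx mul1r big1 ?addr0 // => v /negbTE->.
  by rewrite mul0r.
by rewrite iterSr IH sum_occupancyS.
Qed.

(** * Truncated likelihood ratios *)

Section Mean.
Variables (R : realFieldType) (X : finType).

Definition mean (f : X -> R) : R := (\sum_x f x) / #|X|%:R.

Lemma mean_ge0 (f : X -> R) : (forall x, 0 <= f x) -> 0 <= mean f.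
Proof. by move=> f0; rewrite divr_ge0 // sumr_ge0. Qed.

Lemma ler_mean (f g : X -> R) : (forall x, f x <= g x) -> mean f <= mean g.
Proof. by move=> fg; rewrite ler_wpM2r ?invr_ge0 // ler_sum. Qed.

Lemma mean_sum (I : finType) (P : pred I) (c : I -> R) (f : I -> X -> R) :
  mean (fun x => \sum_(i | P i) c i * f i x) = \sum_(i | P i) c i * mean (f i).
Proof.
rewrite /mean exchange_big mulr_suml /=; apply: eq_bigr => i _.
by rewrite -mulr_sumr mulrA.
Qed.

Lemma meanZ (a : R) (f : X -> R) : mean (fun x => a * f x) = a * mean f.
Proof. by rewrite /mean -mulr_sumr mulrA. Qed.

Lemma meanD (f g : X -> R) : mean (fun x => f x + g x) = mean f + mean g.
Proof. by rewrite /mean big_split mulrDl. Qed.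

Lemma meanB (f g : X -> R) : mean (fun x => f x - g x) = mean f - mean g.
Proof. by rewrite /mean sumrB mulrBl. Qed.

Lemma eq_mean (f g : X -> R) : f =1 g -> mean f = mean g.
Proof. by move=> fg; congr (_ / _); apply: eq_bigr. Qed.

Lemma mean_cst (a : R) : (0 < #|X|)%N -> mean (fun=> a) = a.
Proof.
move=> X0; rewrite /mean sumr_const -[a in LHS]mulr1 -mulrnAr.
by rewrite -mulrA divff ?mulr1 // pnatr_eq0 -lt0n.
Qed.

End Mean.

Section TruncatedLikelihood.
Variables (R : realFieldType) (S X V : finType) (step : V -> S -> V) (v0 : V).
Variables (D : S -> R) (L : S -> X -> R) (B lam : R).
Hypothesis D_ge0 : forall s, 0 <= D s.
Hypothesis sum_D : \sum_s D s = 1.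
Hypothesis L_bound : forall s x, 0 <= L s x <= 2.
Hypothesis sum_DL : forall x, \sum_s D s * L s x = 1.
Hypothesis X_gt0 : (0 < #|X|)%N.
Hypothesis B_ge1 : 1 <= B.
Hypothesis lam_ge0 : 0 <= lam.
(** It is applied to [h = phi * g] with [phi <= B] and [g <= B ^+ 2], hence the cube. *)
Hypothesis decorrelation : forall h : X -> R, (forall x, 0 <= h x <= B ^+ 3) ->
  \sum_s D s * mean (fun x => h x * (L s x - 1)) ^+ 2 <= lam * (1 + mean h) ^+ 2.

Local Notation q := (occupancy step v0 D).

Lemma sum_merge (F : V * S -> R) :
  \sum_v \sum_(p : V * S | step p.1 p.2 == v) F p = \sum_v \sum_s F (v, s).
Proof.
rewrite (pair_big predT predT (fun v s => F (v, s))) /=.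
rewrite [RHS](partition_big (fun p : V * S => step p.1 p.2) predT) //=.
by apply: eq_bigr => v _; apply: eq_bigr => -[].
Qed.

(* Likelihood ratio at v after one more sample, for ratios phi at the previous
   time: a q-weighted average over the edges entering v; it is 0 when v has
   q-probability 0. *)
Definition merged_ratio t (phi : V -> X -> R) (v : V) (x : X) : R :=
  (\sum_(p : V * S | step p.1 p.2 == v)
     q t p.1 * D p.2 * (phi p.1 x * L p.2 x)) / q t.+1 v.

(** Truncated ratios are fed back into the merging, so discarded mass never returns and [q * phi]
    stays below the true probability. *)
Fixpoint trunc_ratio t : V -> X -> R :=
  if t is t'.+1 then fun v x =>
    if merged_ratio t' (trunc_ratio t') v x <= B
    then merged_ratio t' (trunc_ratio t') v x else 0
  else fun _ _ => 1.

Local Notation phi := trunc_ratio.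
Local Notation phi' := (fun t => merged_ratio t (trunc_ratio t)).

Let q_ge0 t v : 0 <= q t v. Proof. exact: occupancy_ge0. Qed.

Let w_ge0 t (p : V * S) : 0 <= q t p.1 * D p.2. Proof. by rewrite mulr_ge0. Qed.

Let B_ge0 : 0 <= B. Proof. exact: le_trans ler01 B_ge1. Qed.

Let L_ge0 s x : 0 <= L s x. Proof. by case/andP: (L_bound s x). Qed.

Lemma merged_ratio_ge0 t (f : V -> X -> R) v x :
  (forall v x, 0 <= f v x) -> 0 <= merged_ratio t f v x.
Proof.
move=> f0; rewrite divr_ge0 // sumr_ge0 // => p _.
by rewrite mulr_ge0 // mulr_ge0.
Qed.

Lemma trunc_ratio_bound t v x : 0 <= phi t v x <= B.
Proof.
elim: t v x => [|t IH] v x /=; first by rewrite ler01.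
case: ifPn => [->|_]; last by rewrite lexx.
by rewrite andbT merged_ratio_ge0 // => w z; case/andP: (IH w z).
Qed.

Lemma trunc_ratio_ge0 t v x : 0 <= phi t v x.
Proof. by case/andP: (trunc_ratio_bound t v x). Qed.

Lemma merged_trunc_ratio_bound t v x : 0 <= phi' t v x <= 2 * B.
Proof.
rewrite merged_ratio_ge0 /=; last exact: trunc_ratio_ge0.
rewrite /merged_ratio; have [->|qn0] := eqVneq (q t.+1 v) 0.
  by rewrite invr0 mulr0 mulr_ge0.
have q_gt0 : 0 < q t.+1 v by rewrite lt0r qn0 q_ge0.
rewrite ler_pdivrMr // [X in _ * X]/= mulr_sumr.
apply: ler_sum => p _; rewrite [leRHS]mulrC ler_wpM2l // mulrC.
have /andP[l0 l2] := L_bound p.2 x; have /andP[f0 fB] := trunc_ratio_bound t p.1 x.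
exact: ler_pM.
Qed.

Lemma trunc_ratioS_le t v x : phi t.+1 v x <= phi' t v x.
Proof.
by rewrite /=; case: ifP => // _; case/andP: (merged_trunc_ratio_bound t v x).
Qed.

Lemma mul_occupancy_merged t (f : V -> X -> R) v x :
  q t.+1 v * merged_ratio t f v x = \sum_(p : V * S | step p.1 p.2 == v)
    q t p.1 * D p.2 * (f p.1 x * L p.2 x).
Proof.
rewrite mulrC /merged_ratio; have [q0|qn0] := eqVneq (q t.+1 v) 0; last first.
  by rewrite divfK.
rewrite q0 mulr0 big1 // => p pv.
by rewrite (psumr_eq0P _ q0) ?mul0r // => i _; exact: w_ge0.
Qed.

(** * Moment growth under one sample, and the potential *)

Lemma mean_merged_ratio t (f : V -> X -> R) (g : X -> R) v :
  mean (fun x => merged_ratio t f v x * g x)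
  = (\sum_(p : V * S | step p.1 p.2 == v)
      q t p.1 * D p.2 * mean (fun x => f p.1 x * g x * L p.2 x)) / q t.+1 v.
Proof.
rewrite -mean_sum mulrC -meanZ; apply: eq_mean => x.
rewrite /merged_ratio mulrAC mulrC; congr (_ * _).
rewrite mulr_suml; apply: eq_bigr => p _; ring.
Qed.

(** With [c = 1 + mean h], each sample multiplies the base by [1 + z s / c], where [z] has mean 0
    under [D] and is at most [c] in absolute value. In the quadratic expansion the linear term
    vanishes and [decorrelation] bounds the rest. *)
Lemma moment_after_sample (h : X -> R) (K : nat) :
  (forall x, 0 <= h x <= B ^+ 3) ->
  \sum_s D s * (1 + mean (fun x => h x * L s x)) ^+ K
    <= (1 + 3 ^+ K * lam) * (1 + mean h) ^+ K.
Proof.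
move=> hB; have h0 x : 0 <= h x by case/andP: (hB x).
have y0 : 0 <= mean h by exact: mean_ge0.
pose z s := mean (fun x => h x * (L s x - 1)).
pose c := 1 + mean h.
have c0 : 0 < c by rewrite /c; lra.
have hL s : 1 + mean (fun x => h x * L s x) = c * (1 + z s / c).
  rewrite mulrDr mulr1 [c * _]mulrC divfK ?gt_eqF // /c /z -addrA -meanD.
  by congr (_ + _); apply: eq_mean => x; ring.
have zc s : -1 <= z s / c <= 1.
  rewrite ler_pdivlMr // ler_pdivrMr // mulN1r mul1r.
  have -> : - c = -1 + (-1) * mean h by rewrite /c; ring.
  rewrite -meanZ; apply/andP; split.
    apply: (@le_trans _ _ (mean (fun x => -1 * h x))); first by lra.
    apply: ler_mean => x; rewrite mulrC ler_wpM2l //.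
    by have /andP[? _] := L_bound s x; lra.
  apply: (@le_trans _ _ (mean h)); last by rewrite /c; lra.
  apply: ler_mean => x; rewrite ler_piMr //.
  by have /andP[_ ?] := L_bound s x; lra.
have Dz : \sum_s D s * z s = 0.
  rewrite -mean_sum -[RHS](@mean_cst R X 0 X_gt0); apply: eq_mean => x.
  transitivity (h x * (\sum_s D s * L s x - \sum_s D s)).
    rewrite -sumrB mulr_sumr; apply: eq_bigr => s _; ring.
  by rewrite sum_DL sum_D subrr mulr0.
apply: (@le_trans _ _ (\sum_s (c ^+ K * D s + c ^+ K * K%:R / c * (D s * z s)
    + c ^+ K * 3 ^+ K / c ^+ 2 * (D s * z s ^+ 2)))).
  apply: ler_sum => s _; rewrite hL exprMn.
  apply: le_trans (_ : D s * (c ^+ K * (1 + K%:R * (z s / c)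
      + 3 ^+ K * (z s / c) ^+ 2)) <= _).
    by rewrite ler_wpM2l // ler_wpM2l ?exprn_ge0 ?(ltW c0) // pow_quadratic_ub.
  rewrite le_eqVlt; apply/orP; left; apply/eqP; rewrite expr_div_n.
  by field; rewrite gt_eqF.
rewrite !big_split /= -!mulr_sumr sum_D Dz mulr0 addr0 mulr1.
rewrite [leRHS]mulrDl mul1r lerD2l.
apply: (@le_trans _ _ (c ^+ K * 3 ^+ K / c ^+ 2 * (lam * c ^+ 2))).
  rewrite ler_wpM2l //; last exact: decorrelation.
  by rewrite divr_ge0 ?mulr_ge0 ?exprn_ge0 ?(ltW c0).
rewrite le_eqVlt; apply/orP; left; apply/eqP; rewrite /c.
by field; rewrite gt_eqF.
Qed.

(** The shift by 1 matches the factor [(1 + mean h) ^+ 2] in [decorrelation]. *)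
Definition potential (K : nat) (g : X -> R) (f : V -> X -> R) (t : nat) : R :=
  \sum_v q t v * (1 + mean (fun x => f v x * g x)) ^+ K.

(** Jensen over the edges entering each vertex undoes the merging; [moment_after_sample] then
    applies at each old vertex. *)
Lemma potential_merged (K : nat) (g : X -> R) t :
  (forall x, 0 <= g x <= B ^+ 2) ->
  potential K g (phi' t) t.+1 <= (1 + 3 ^+ K * lam) * potential K g (phi t) t.
Proof.
move=> gB; have g0 x : 0 <= g x by case/andP: (gB x).
apply: (@le_trans _ _ (\sum_v \sum_(p : V * S | step p.1 p.2 == v)
   q t p.1 * D p.2 * (1 + mean (fun x => phi t p.1 x * g x * L p.2 x)) ^+ K)).
  apply: ler_sum => v _; rewrite mean_merged_ratio; apply: jensen_pow => [p|p] //.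
  by apply: mean_ge0 => x; rewrite !mulr_ge0 // trunc_ratio_ge0.
rewrite sum_merge /= mulr_sumr.
apply: ler_sum => v _; rewrite mulrCA.
under eq_bigr do rewrite -mulrA.
rewrite -mulr_sumr ler_wpM2l //; apply: moment_after_sample => x.
have /andP[f0 fB] := trunc_ratio_bound t v x; have /andP[? gx] := gB x.
by rewrite mulr_ge0 //= exprS ler_pM.
Qed.

Lemma potential_truncS (K : nat) (g : X -> R) t : (forall x, 0 <= g x) ->
  potential K g (phi t.+1) t.+1 <= potential K g (phi' t) t.+1.
Proof.
move=> g0; apply: ler_sum => v _; rewrite ler_wpM2l //.
have m0 f : (forall x, 0 <= f x) -> 0 <= 1 + mean (fun x => f x * g x).
  by move=> f0; rewrite addr_ge0 // mean_ge0 // => x; rewrite mulr_ge0.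
rewrite lerXn2r ?nnegrE ?m0 //.
- exact: trunc_ratio_ge0.
- by move=> x; case/andP: (merged_trunc_ratio_bound t v x).
- by rewrite lerD2l ler_mean // => x; rewrite ler_wpM2r // trunc_ratioS_le.
Qed.

Lemma potential_trunc_ub (K : nat) (g : X -> R) t :
  (forall x, 0 <= g x <= B ^+ 2) -> mean g = 1 ->
  potential K g (phi t) t <= 2 ^+ K * (1 + 3 ^+ K * lam) ^+ t.
Proof.
move=> gB g1; have g0 x : 0 <= g x by case/andP: (gB x).
have e0 : 0 <= 1 + 3 ^+ K * lam by rewrite addr_ge0 // mulr_ge0 // exprn_ge0.
elim: t => [|t IH].
  rewrite expr0 mulr1 /potential.
  have m1 v : mean (fun x => phi 0 v x * g x) = 1.
    by rewrite -[RHS]g1; apply: eq_mean => x; rewrite mul1r.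
  under eq_bigr do rewrite m1.
  by rewrite -mulr_suml sum_occupancy // mul1r.
apply: (le_trans (potential_truncS _ _ g0)).
apply: (le_trans (potential_merged _ _ gB)).
by rewrite exprS mulrCA ler_wpM2l.
Qed.

(** * Mass lost by truncation *)

Definition mass t : R := \sum_v q t v * mean (phi t v).

(** Reading a sample preserves the total mass because each [L s x] integrates to 1; only truncation
    loses any. *)
Lemma mass_merged t : \sum_v q t.+1 v * mean (phi' t v) = mass t.
Proof.
transitivity (\sum_v \sum_(p : V * S | step p.1 p.2 == v)
   q t p.1 * D p.2 * mean (fun x => phi t p.1 x * L p.2 x)).
  apply: eq_bigr => v _; rewrite -meanZ -mean_sum; apply: eq_mean => x.
  exact: mul_occupancy_merged.
rewrite sum_merge /=.
apply: eq_bigr => v _; under eq_bigr do rewrite -mulrA.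
rewrite -mulr_sumr -mean_sum; congr (_ * _); apply: eq_mean => x.
under eq_bigr do rewrite mulrCA.
by rewrite -mulr_sumr sum_DL mulr1.
Qed.

(* With S = {phi' > B} of density mu: if mu <= B^-2 the loss is at most
   q * 2B * B^-2, as phi' <= 2B; otherwise g = 1_S / mu <= B^2 is a legitimate
   weight and the potential forces q * B^K to be small. *)
Lemma truncation_loss (K : nat) t v :
  q t.+1 v * mean (phi' t v) - q t.+1 v * mean (phi t.+1 v)
  <= q t.+1 v * (2 / B) + 2 * B * (2 ^+ K * (1 + 3 ^+ K * lam) ^+ t.+1) / B ^+ K.
Proof.
have B_gt0 : 0 < B by exact: lt_le_trans ltr01 B_ge1.
have e0 : 0 <= 1 + 3 ^+ K * lam by rewrite addr_ge0 // mulr_ge0 // exprn_ge0.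
set Cap := 2 ^+ K * _.
have Cap0 : 0 <= Cap by rewrite mulr_ge0 // exprn_ge0.
pose ind x : R := (B < phi' t v x)%R%:R; pose mu := mean ind.
have ind0 x : 0 <= ind x by exact: ler0n.
have mu0 : 0 <= mu by exact: mean_ge0.
have mu1 : mu <= 1.
  rewrite -(@mean_cst R X 1 X_gt0); apply: ler_mean => x.
  by rewrite /ind; case: ltP.
have loss : q t.+1 v * mean (phi' t v) - q t.+1 v * mean (phi t.+1 v)
    <= q t.+1 v * (2 * B * mu).
  rewrite -mulrBr ler_wpM2l // -meanB -meanZ; apply: ler_mean => x.
  rewrite /= /ind; case: leP => _; first by rewrite subrr mulr0.
  by rewrite subr0 mulr1; case/andP: (merged_trunc_ratio_bound t v x).
apply: (le_trans loss); have [mu_le|mu_gt] := leP mu (B ^- 2).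
  apply: (@le_trans _ _ (q t.+1 v * (2 / B))); last first.
    by rewrite lerDl divr_ge0 ?mulr_ge0 ?exprn_ge0.
  rewrite ler_wpM2l //; apply: (@le_trans _ _ (2 * B * B ^- 2)).
    by rewrite ler_wpM2l // mulr_ge0.
  by rewrite le_eqVlt; apply/orP; left; apply/eqP; field; rewrite gt_eqF.
have mu_gt0 : 0 < mu by apply: lt_trans mu_gt; rewrite invr_gt0 exprn_gt0.
pose g x := mu^-1 * ind x.
have gB x : 0 <= g x <= B ^+ 2.
  rewrite mulr_ge0 ?invr_ge0 //= -[leRHS]mulr1.
  apply: ler_pM; rewrite ?invr_ge0 //; last by rewrite /ind; case: ltP.
  by rewrite -[leRHS]invrK lef_pV2 ?posrE ?invr_gt0 ?exprn_gt0 // ltW.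
have g1 : mean g = 1 by rewrite meanZ mulVf ?gt_eqF.
have g0 x : 0 <= g x by case/andP: (gB x).
have p0 w x : 0 <= phi' t w x by case/andP: (merged_trunc_ratio_bound t w x).
have m0 w : 0 <= mean (fun x => phi' t w x * g x).
  by apply: mean_ge0 => x; rewrite mulr_ge0.
have Bm : B <= mean (fun x => phi' t v x * g x).
  rewrite -[leLHS]mulr1 -g1 -meanZ; apply: ler_mean => x; rewrite /g /ind.
  by case: ltP => [/ltW h|_]; rewrite ?mulr0 // ler_wpM2r // mulr1 invr_ge0.
have qCap : q t.+1 v * B ^+ K <= Cap.
  apply: (@le_trans _ _ (potential K g (phi' t) t.+1)); last first.
    apply: (le_trans (potential_merged _ _ gB)).
    rewrite /Cap exprS mulrCA ler_wpM2l //; exact: potential_trunc_ub.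
  rewrite /potential (bigD1 v) //; apply: (@le_trans _ _ (q t.+1 v *
      (1 + mean (fun x => phi' t v x * g x)) ^+ K)).
    rewrite ler_wpM2l // lerXn2r ?nnegrE //; first by rewrite addr_ge0.
    by apply: (le_trans Bm); rewrite lerDr.
  rewrite lerDl sumr_ge0 // => w _.
  by rewrite mulr_ge0 // exprn_ge0 // addr_ge0.
apply: (@le_trans _ _ (2 * B * (Cap / B ^+ K))); last first.
  by rewrite mulrA lerDr mulr_ge0 // divr_ge0.
rewrite mulrCA ler_wpM2l ?mulr_ge0 // ler_pdivlMr ?exprn_gt0 //.
apply: le_trans qCap; rewrite mulrAC ler_piMr //.
by rewrite mulr_ge0 // exprn_ge0.
Qed.

(** Per time step, the term [2 / B] is weighted by [q] and so paid once, while the potential term is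
    paid for every vertex: this is where memory enters. *)
Definition lost_mass (K m : nat) : R := m%:R *
  (2 / B + #|V|%:R * (2 * B * (2 ^+ K * (1 + 3 ^+ K * lam) ^+ m) / B ^+ K)).

Lemma mass_lb (K m : nat) : 1 - lost_mass K m <= mass m.
Proof.
have e1 : 1 <= 1 + 3 ^+ K * lam by rewrite lerDl mulr_ge0 // exprn_ge0.
rewrite /lost_mass; set C := (X in X / B ^+ K); set r := (X in _ * X).
suff H t : (t <= m)%N -> 1 - t%:R * r <= mass t by exact: H.
elim: t => [_|t IH tm].
  rewrite mul0r subr0 /mass.
  under eq_bigr do rewrite mean_cst //.
  by rewrite -mulr_suml sum_occupancy ?mul1r.
have := IH (ltnW tm); rewrite -natr1 mulrDl mul1r => h.
suff : mass t - mass t.+1 <= r by lra.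
rewrite -mass_merged /mass -sumrB.
apply: (le_trans (ler_sum _ (fun v _ => truncation_loss K t v))).
rewrite big_split -mulr_suml sum_occupancy // mul1r /= sumr_const lerD2l.
rewrite -[leLHS]mulr_natl ler_wpM2l // ler_wpM2r ?invr_ge0 ?exprn_ge0 //.
rewrite /C ler_wpM2l ?mulr_ge0 // ler_wpM2l ?exprn_ge0 //.
by rewrite ler_weXn2l.
Qed.

(** * From the chi-square distance to acceptance probabilities *)

Lemma trunc_ratio_le_occupancy t v x :
  q t v * phi t v x <= occupancy step v0 (fun s => D s * L s x) t v.
Proof.
elim: t v => [|t IH] v; first by rewrite mulr1.
apply: (@le_trans _ _ (q t.+1 v * phi' t v x)).
  by rewrite ler_wpM2l // trunc_ratioS_le.
rewrite mul_occupancy_merged; apply: ler_sum => p _.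
by rewrite mulrACA ler_wpM2r // mulr_ge0.
Qed.

(** Since [(1 + y) ^+ 2 = (y - 1) ^+ 2 + 4 * y], the potential with [K = 2] and [g = 1] is the
    chi-square sum plus [4 * mass m]. *)
Lemma chi_square_ub m :
  \sum_v q m v * (mean (phi m v) - 1) ^+ 2 <= 4 * ((1 + 9 * lam) ^+ m - mass m).
Proof.
have oneB (x : X) : 0 <= (1 : R) <= B ^+ 2 by rewrite ler01 exprn_ege1.
have := @potential_trunc_ub 2 (fun=> 1) m oneB (mean_cst _ X_gt0).
have -> : 2 ^+ 2 = 4 :> R by ring.
have -> : 3 ^+ 2 = 9 :> R by ring.
rewrite mulrBr => h; rewrite lerBrDr; apply: le_trans h.
rewrite /mass mulr_sumr -big_split /=.
apply: ler_sum => v _.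
have -> : mean (fun x => phi m v x * 1) = mean (phi m v).
  by apply: eq_mean => x; rewrite mulr1.
by rewrite le_eqVlt; apply/orP; left; apply/eqP; ring.
Qed.

(** The true probability [F] splits as [q], plus [q * mean phi - q], plus a nonnegative remainder of
    total [1 - mass m]. The middle part uses [y - 1 <= tau + (y - 1) ^+ 2 / tau]. *)
Lemma likelihood_accept_ub (K m : nat) (l : pred V) (tau : R) : 0 < tau ->
  mean (fun x => \sum_(v | l v) occupancy step v0 (fun s => D s * L s x) m v)
  <= \sum_(v | l v) q m v
     + (tau + 4 * ((1 + 9 * lam) ^+ m - 1 + lost_mass K m) / tau + lost_mass K m).
Proof.
move=> tau0.
pose F v := mean (fun x => occupancy step v0 (fun s => D s * L s x) m v).
have qF v : q m v * mean (phi m v) <= F v.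
  by rewrite -meanZ; apply: ler_mean => x; exact: trunc_ratio_le_occupancy.
have sumF : \sum_v F v = 1.
  transitivity (mean (fun x => \sum_v 1 * occupancy step v0 (fun s => D s * L s x) m v)).
    by rewrite mean_sum; apply: eq_bigr => v _; rewrite mul1r.
  rewrite -[RHS](@mean_cst R X 1 X_gt0); apply: eq_mean => x.
  by under eq_bigr do rewrite mul1r; exact: sum_occupancy.
have -> : mean (fun x => \sum_(v | l v) occupancy step v0 (fun s => D s * L s x) m v)
    = \sum_(v | l v) F v.
  rewrite -[RHS](eq_bigr _ (fun v _ => mul1r _)) -mean_sum; apply: eq_mean => x.
  by apply: eq_bigr => v _; rewrite mul1r.
have mass_m := mass_lb K m.
have chi : \sum_v q m v * (mean (phi m v) - 1) ^+ 2
    <= 4 * ((1 + 9 * lam) ^+ m - 1 + lost_mass K m).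
  apply: (le_trans (chi_square_ub m)); rewrite ler_wpM2l //; lra.
have lossF : \sum_(v | l v) (F v - q m v * mean (phi m v)) <= lost_mass K m.
  apply: (@le_trans _ _ (\sum_v (F v - q m v * mean (phi m v)))).
    rewrite [leRHS](bigID l) /= lerDl sumr_ge0 // => v _.
    by rewrite subr_ge0.
  rewrite sumrB sumF -/(mass m); lra.
have gain : \sum_(v | l v) (q m v * mean (phi m v) - q m v)
    <= tau + (4 * ((1 + 9 * lam) ^+ m - 1 + lost_mass K m)) / tau.
  apply: (@le_trans _ _ (\sum_v (q m v * tau + q m v * (mean (phi m v) - 1) ^+ 2 / tau))).
    rewrite [leRHS](bigID l) /= -[leLHS]addr0; apply: lerD; last first.
      apply: sumr_ge0 => v _.
      rewrite -mulrA -mulrDr mulr_ge0 // addr_ge0 ?(ltW tau0) //.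
      by rewrite divr_ge0 ?sqr_ge0 // ltW.
    apply: ler_sum => v _; set y := mean _.
    have -> : q m v * y - q m v = q m v * (y - 1) by ring.
    rewrite -mulrA -mulrDr ler_wpM2l // -(ler_pM2r tau0) [leRHS]mulrDl divfK ?gt_eqF //.
    by have := sqr_ge0 (y - 1 - tau); have := sqr_ge0 (y - 1 + tau); lra.
  rewrite big_split /= -!mulr_suml sum_occupancy // mul1r lerD2l.
  by rewrite ler_wpM2r // invr_ge0 ltW.
have -> : \sum_(v | l v) F v = \sum_(v | l v) q m v
  + \sum_(v | l v) (q m v * mean (phi m v) - q m v)
  + \sum_(v | l v) (F v - q m v * mean (phi m v)).
  by rewrite -!big_split; apply: eq_bigr => v _ /=; ring.
rewrite -addrA lerD2l; exact: lerD.
Qed.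

End TruncatedLikelihood.

(** * Decorrelation of sparse parities *)

Section SparseParity.
Variables (R : realType) (n k : nat).

Local Notation p := (k%:R / n%:R : R).

Definition character (a x : bitvec n) : R := (-1) ^+ inner2 a x.

Definition hamming (x y : bitvec n) : nat := #|[pred i | x i != y i]|.

Definition parity_ratio (s : sample n) (x : bitvec n) : R :=
  2 * (s.2 == inner2 s.1 x)%:R.

Lemma sum_prod_bits (F : 'I_n -> bool -> R) :
  \sum_(a : bitvec n) \prod_i F i (a i) = \prod_i (F i true + F i false).
Proof.
by rewrite -bigA_distr_bigA; apply: eq_bigr => i _; rewrite big_bool.
Qed.

Lemma character_prod (a x : bitvec n) :
  character a x = \prod_i (-1) ^+ (a i && x i).
Proof. by rewrite /character /inner2 signr_odd expr_sum. Qed.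

Lemma prod_hamming (x y : bitvec n) (c : R) :
  \prod_i (if x i == y i then 1 else c) = c ^+ hamming x y.
Proof.
rewrite (bigID (fun i => x i == y i)) /= big1 => [|i ->//]; rewrite mul1r.
rewrite (eq_bigr (fun=> c)) => [|i /negbTE->//].
by rewrite prodr_const.
Qed.

Lemma sum_hamming (x : bitvec n) (c : R) :
  \sum_y c ^+ hamming x y = (1 + c) ^+ n.
Proof.
under eq_bigr do rewrite -prod_hamming.
rewrite (sum_prod_bits (fun i b => if x i == b then 1 else c)).
rewrite -[n in RHS]card_ord -prodr_const; apply: eq_bigr => i _.
by case: (x i) => //=; rewrite addrC.
Qed.

(** Coordinates of [a] are independent: one where [x] and [y] agree contributes 1, one where they
    differ contributes the mean of [(-1) ^+ a i], which is [1 - 2 * p]. *)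
Lemma character_covariance (x y : bitvec n) :
  \sum_a sparse_pmf R k a * (character a x * character a y)
  = (1 - 2 * p) ^+ hamming x y.
Proof.
rewrite -prod_hamming.
transitivity (\sum_(a : bitvec n) \prod_i (bernoulli_pmf p (a i)
    * ((-1) ^+ (a i && x i) * (-1) ^+ (a i && y i)))).
  apply: eq_bigr => a _; rewrite !character_prod /sparse_pmf.
  by rewrite -!big_split.
rewrite (sum_prod_bits (fun i b => bernoulli_pmf p b
    * ((-1) ^+ (b && x i) * (-1) ^+ (b && y i)))).
apply: eq_bigr => i _; rewrite /bernoulli_pmf /=.
by case: (x i); case: (y i) => /=; rewrite ?expr0 ?expr1; ring.
Qed.

Lemma sum_sparse_pmf : \sum_a sparse_pmf R (n:=n) k a = 1.
Proof.
rewrite (sum_prod_bits (fun=> bernoulli_pmf p)) big1 // => i _.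
rewrite /bernoulli_pmf; ring.
Qed.

Lemma sum_sample (F : sample n -> R) : \sum_s F s = \sum_a (F (a, true) + F (a, false)).
Proof.
rewrite (eq_bigr (fun s => F (s.1, s.2))) => [|[]//].
rewrite -(pair_big predT predT (fun a b => F (a, b))) /=.
by apply: eq_bigr => a _; rewrite big_bool.
Qed.

Lemma sum_D0 : \sum_s D0 R (n:=n) k s = 1.
Proof.
rewrite sum_sample -[RHS]sum_sparse_pmf; apply: eq_bigr => a _.
by rewrite /D0 /=; field.
Qed.

Lemma D1E (x : bitvec n) s : D1 R k x s = D0 R k s * parity_ratio s x.
Proof. by rewrite /D1 /D0 /parity_ratio; field. Qed.

Lemma sum_D1 (x : bitvec n) : \sum_s D1 R k x s = 1.
Proof.
rewrite sum_sample -[RHS]sum_sparse_pmf; apply: eq_bigr => a _.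
by rewrite /D1 /=; case: inner2 => /=; ring.
Qed.

Lemma parity_ratio_bound s x : 0 <= parity_ratio s x <= 2.
Proof. by rewrite /parity_ratio; case: eqP => _ /=; rewrite ?mulr1 ?mulr0; lra. Qed.

Lemma parity_ratio_sub1 (a : bitvec n) b x :
  parity_ratio (a, b) x - 1 = (-1) ^+ b.+1 * - character a x.
Proof.
by rewrite /parity_ratio /character /=; case: b; case: inner2 => /=; ring.
Qed.

Hypothesis n_gt0 : (0 < n)%N.
Hypothesis k_small : k%:R <= n%:R / 4 :> R.

Let n_gt0R : 0 < n%:R :> R. Proof. by rewrite ltr0n. Qed.

Let p_bound : 0 <= p <= 1 / 4.
Proof.
rewrite divr_ge0 //= ler_pdivrMr //; move: k_small; lra.
Qed.

Lemma sparse_pmf_ge0 (a : bitvec n) : 0 <= sparse_pmf R k a.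
Proof.
apply: prodr_ge0 => i _; rewrite /bernoulli_pmf.
by have := p_bound; case: (a i) => ? /=; lra.
Qed.

(* The second term dominates 1 when 8 |x + y| < n, because (3/2)^8 >= 16; its
   average over y is (51/64)^n. *)
Lemma covariance_ub (x y : bitvec n) :
  (1 - 2 * p) ^+ hamming x y
  <= expR (- (k%:R / 4)) + (3 / 2) ^+ n * 16^-1 ^+ hamming x y.
Proof.
have /andP[p0 p4] := p_bound.
(* For far pairs the exponent [2 * p * hamming x y] is at least [2 * (k / n) * (n / 8) = k / 4]. *)
have [far|near] := leqP n (8 * hamming x y).
  rewrite -[leLHS]addr0; apply: lerD; last by rewrite mulr_ge0 ?exprn_ge0 //; lra.
  apply: (@le_trans _ _ (expR (- (2 * p)) ^+ hamming x y)).
    rewrite lerXn2r ?nnegrE ?expR_ge0 //; first by lra.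
    exact: expR_ge1Dx.
  rewrite -expRM_natl ler_expR mulrN lerN2.
  have : n%:R <= 8 * (hamming x y)%:R :> R by rewrite -natrM ler_nat.
  move=> h; apply: (@le_trans _ _ (8^-1 * n%:R * (2 * p))).
    by rewrite le_eqVlt; apply/orP; left; apply/eqP; field; rewrite gt_eqF.
  by rewrite ler_wpM2r //; lra.
rewrite -[leLHS]add0r; apply: lerD; first exact: expR_ge0.
apply: (@le_trans _ _ 1); first by rewrite exprn_ile1 //; lra.
apply: (@le_trans _ _ ((3 / 2) ^+ (8 * hamming x y) * 16^-1 ^+ hamming x y)).
  rewrite exprM -exprMn exprn_ege1 //.
  by rewrite !exprS expr0; lra.
rewrite ler_wpM2r ?exprn_ge0 //; apply: ler_weXn2l; [lra|exact: ltnW].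
Qed.

(** Expanding the square over two copies [x], [y] turns the sum over [a] into the covariance kernel,
    which [covariance_ub] bounds pointwise. *)
Lemma character_second_moment (h : bitvec n -> R) (H : R) :
  (forall x, 0 <= h x <= H) ->
  \sum_a sparse_pmf R k a * mean (fun x => h x * character a x) ^+ 2
  <= expR (- (k%:R / 4)) * mean h ^+ 2 + (51 / 64) ^+ n * H ^+ 2.
Proof.
move=> hH; have h0 x : 0 <= h x by case/andP: (hH x).
have hle x : h x <= H by case/andP: (hH x).
have card : #|bitvec n|%:R = 2 ^+ n :> R.
  by rewrite card_ffun card_bool card_ord natrX.
have cov : \sum_a sparse_pmf R k a * mean (fun x => h x * character a x) ^+ 2
    = mean (fun x => h x * mean (fun y => h y * (1 - 2 * p) ^+ hamming x y)).
  transitivity (mean (fun x => \sum_a sparse_pmf R k a *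
      (mean (fun y => h x * (h y * (character a x * character a y)))))).
    rewrite mean_sum; apply: eq_bigr => a _; congr (_ * _).
    rewrite expr2 -meanZ; apply: eq_mean => x.
    by rewrite mulrC -meanZ; apply: eq_mean => y; ring.
  apply: eq_mean => x; rewrite -mean_sum -meanZ; apply: eq_mean => y.
  rewrite -character_covariance !mulr_sumr.
  apply: eq_bigr => a _; ring.
rewrite cov; apply: (@le_trans _ _ (mean (fun x =>
    h x * (expR (- (k%:R / 4)) * mean h) + (51 / 64) ^+ n * H ^+ 2))).
  apply: ler_mean => x.
  apply: (@le_trans _ _ (h x * mean (fun y => expR (- (k%:R / 4)) * h y
     + (3 / 2) ^+ n * H * 16^-1 ^+ hamming x y))).
    rewrite ler_wpM2l //; apply: ler_mean => y.
    apply: (le_trans (ler_wpM2l (h0 y) (covariance_ub x y))).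
    rewrite mulrDr [h y * expR _]mulrC lerD2l mulrA ler_wpM2r ?exprn_ge0 //.
    by rewrite mulrC ler_wpM2l // exprn_ge0.
  rewrite meanD !meanZ mulrDr lerD2l.
  rewrite {1}/mean sum_hamming card -expr_div_n.
  have -> : (1 + 16^-1) / 2 = 17 / 32 :> R by lra.
  have -> : (51 / 64) ^+ n = (3 / 2) ^+ n * (17 / 32) ^+ n :> R.
    by rewrite -exprMn; congr (_ ^+ _); lra.
  rewrite expr2.
  have -> : h x * ((3 / 2) ^+ n * H * (17 / 32) ^+ n)
    = (3 / 2) ^+ n * (17 / 32) ^+ n * (h x * H) by ring.
  have H0 : 0 <= H by exact: le_trans (hle x).
  apply: ler_wpM2l; last exact: ler_wpM2r.
  by rewrite mulr_ge0 // exprn_ge0.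
rewrite meanD mean_cst ?card_ffun ?card_bool ?expn_gt0 //.
rewrite lerD2r expr2 [leRHS]mulrA -[leRHS]meanZ.
by apply: ler_mean => x; rewrite mulrC.
Qed.

Lemma parity_decorrelation (h : bitvec n -> R) :
  (forall x, 0 <= h x <= expR (n%:R / 64) ^+ 3) ->
  \sum_s D0 R k s * mean (fun x => h x * (parity_ratio s x - 1)) ^+ 2
  <= expR (- (k%:R / 4)) * (1 + mean h) ^+ 2.
Proof.
move=> hB; have y0 : 0 <= mean h by apply: mean_ge0 => x; case/andP: (hB x).
rewrite sum_sample.
have sq a b : mean (fun x => h x * (parity_ratio (a, b) x - 1)) ^+ 2
    = mean (fun x => h x * character a x) ^+ 2.
  have -> : mean (fun x => h x * (parity_ratio (a, b) x - 1))
      = (-1) ^+ b * mean (fun x => h x * character a x).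
    rewrite -meanZ; apply: eq_mean => x; rewrite parity_ratio_sub1 exprS; ring.
  by rewrite exprMn sqrr_sign mul1r.
rewrite (eq_bigr (fun a => sparse_pmf R k a *
    mean (fun x => h x * character a x) ^+ 2)); last first.
  by move=> a _; rewrite !sq /D0 /=; field.
apply: (le_trans (character_second_moment hB)).
apply: (@le_trans _ _ (expR (- (k%:R / 4)) * (mean h ^+ 2 + 1))); last first.
  by rewrite ler_wpM2l ?expR_ge0 //; lra.
rewrite mulrDr mulr1 lerD2l.
(* [H ^+ 2] is [exp (6n/64)], so the product is at most [exp (-4n/64)], which is below [exp (-k/4)]
   because [k <= n/4]. *)
have c51 : 51 / 64 <= expR (- (10 / 64)) :> R.
  by apply: le_trans (expR_ge1Dx _); lra.
apply: (@le_trans _ _ (expR (- (10 / 64)) ^+ n * (expR (n%:R / 64) ^+ 3) ^+ 2)).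
  rewrite ler_wpM2r ?exprn_ge0 ?expR_ge0 //.
  by rewrite lerXn2r ?nnegrE ?expR_ge0 //; lra.
rewrite -exprM -!expRM_natl -expRD ler_expR; move: k_small; lra.
Qed.

End SparseParity.

(** * Branching programs *)

Section BranchingProgram.
Variables (S : finType) (m d : nat) (P : branching_program S m d).

(* Leaves are made absorbing, so that paths ending before layer m need no
   special treatment. *)
Definition bp_step (v : vertex P) (a : S) : vertex P :=
  if out v is inr e then e a else v.

(** The default [false] agrees with that of [bp_run], so [bp_run_foldl] holds from any vertex and
    for any input length. *)
Definition bp_label (v : vertex P) : bool := if out v is inl b then b else false.

Lemma bp_run_foldl v us : bp_run v us = bp_label (foldl bp_step v us).
Proof.
elim: us v => [|a us IH] v /=; first by rewrite /bp_label; case: (out v).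
by rewrite -IH /bp_step; case vb: (out v) => [b|e] //; case: us {IH} => /=; rewrite vb.
Qed.

Lemma card_vertex : (#|vertex P| <= m.+1 * d)%N.
Proof.
rewrite -sum1_card (partition_big (@layer _ _ _ P) predT) //=.
rewrite -[X in (_ <= X * _)%N]card_ord -sum_nat_const; apply: leq_sum => i _.
by rewrite sum1_card -cardsE; exact: (@widthP _ _ _ P i).
Qed.

Lemma pr_output_occupancy (R : realType) (D : S -> R) (b : bool) :
  pr_output D (bp_output P) b
  = \sum_(v | bp_label v == b) occupancy bp_step (start P) D m v.
Proof.
rewrite /pr_output [RHS]big_mkcond.
transitivity (\sum_v occupancy bp_step (start P) D m v * (bp_label v == b)%:R).
  rewrite -sum_run_occupancy big_mkcond; apply: eq_bigr => u _.
  rewrite /bp_output bp_run_foldl big_tuple.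
  by case: eqP => _; rewrite ?mulr1 ?mulr0.
by apply: eq_bigr => v _; case: eqP => _; rewrite ?mulr1 ?mulr0.
Qed.

End BranchingProgram.

Lemma success_ub (R : realType) (n k m d : nat)
    (P : branching_program (sample n) m d) (K : nat) (tau : R) :
  (0 < n)%N -> k%:R <= n%:R / 4 :> R -> 0 < tau ->
  let B := expR (n%:R / 64) in let lam := expR (- (k%:R / 4)) in
  let lost := lost_mass (vertex P) B lam K m in
  success R k (bp_output P) <=
    1 / 2 + (tau + 4 * ((1 + 9 * lam) ^+ m - 1 + lost) / tau + lost) / 2.
Proof.
move=> n0 kn tau0 /=; rewrite /success -mulrDl ler_pM2r ?invr_gt0 //.
rewrite pr_output_occupancy.
have -> : (\sum_x pr_output (D1 R k x) (bp_output P) true) / #|bitvec n|%:R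
  = mean (fun x => \sum_(v | bp_label v)
      occupancy (@bp_step _ _ _ P) (start P)
        (fun s => D0 R k s * parity_ratio R s x) m v).
  congr (_ / _); apply: eq_bigr => x _; rewrite pr_output_occupancy.
  have -> : D1 R k x = (fun s => D0 R k s * parity_ratio R s x).
    by apply/funext => s; exact: D1E.
  by apply: eq_bigl => v; rewrite eqb_id.
apply: (le_trans (lerD (lexx _) (@likelihood_accept_ub R _ _ _ _ _ (D0 R k)
  (@parity_ratio R n) (expR (n%:R / 64)) (expR (- (k%:R / 4)))
  _ _ _ _ _ _ _ _ K m _ tau tau0))).
- by move=> s; rewrite /D0 divr_ge0 // sparse_pmf_ge0.
- exact: sum_D0.
- exact: parity_ratio_bound.
- by move=> x; rewrite -(sum_D1 R k x); apply: eq_bigr => s _; rewrite D1E.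
- by rewrite card_ffun card_bool card_ord expn_gt0.
- by rewrite -expR0 ler_expR divr_ge0.
- exact: expR_ge0.
- exact: parity_decorrelation.
(* The 1 is written as the total mass under [D0], split by label into the rejecting and accepting
   parts on the left. *)
rewrite addrA lerD2r -(sum_occupancy (@bp_step _ _ _ P) (start P) m (sum_D0 R n k)).
rewrite [leRHS](bigID (@bp_label _ _ _ P)) /= addrC lerD2l.
by rewrite le_eqVlt; apply/orP; left; apply/eqP; apply: eq_bigl => v; case: bp_label.
Qed.

(** * Choice of constants *)

Section Constants.
Variables (R : realType) (n k m d : nat).
Hypothesis k_small : k%:R <= n%:R / 4 :> R.
Hypothesis n_large : (4096 <= n)%N.
Hypothesis k_large : (6656 <= k)%N.
Hypothesis m_small : m%:R <= expR (k%:R / 64) :> R.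
Hypothesis d_small : d%:R <= expR (n%:R * k%:R / 4096) :> R.

(* [e (-16)] is the decorrelation rate exp(-k/4). *)
Local Notation e c := (expR (c * (k%:R / 64)) : R).
Local Notation K := (k %/ 16)%N.

Let nR : 4096 <= n%:R :> R. Proof. by rewrite (ler_nat R 4096 n). Qed.
Let kR : 6656 <= k%:R :> R. Proof. by rewrite (ler_nat R 6656 k). Qed.

Let K_le : K%:R <= k%:R / 16 :> R.
Proof. by rewrite ler_pdivlMr // -natrM ler_nat leq_divM. Qed.

Let K_ge : k%:R / 16 - 1 <= K%:R :> R.
Proof.
rewrite lerBlDr ler_pdivrMr // natr1 -natrM ler_nat ltnW //.
exact: ltn_ceil.
Qed.

Lemma exp_growth (c : R) : 0 <= c -> (1 + c) ^+ m <= expR (m%:R * c).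
Proof.
move=> c0; rewrite expRM_natl lerXn2r ?nnegrE ?expR_ge0 ?addr_ge0 //.
exact: expR_ge1Dx.
Qed.

Let e_decr (a b : R) : a <= b -> e a <= e b.
Proof. by move=> ab; rewrite ler_expR ler_wpM2r. Qed.

(** With [3 <= exp 2] and [K <= k/16], the exponent [m * 3 ^+ K * lam] is at most
    [e (1 + 8 - 16) <= 1]. *)
Lemma growth_K : (1 + 3 ^+ K * e (-16)) ^+ m <= expR 1.
Proof.
apply: (le_trans (exp_growth _)); first by rewrite mulr_ge0 ?exprn_ge0 ?expR_ge0.
rewrite ler_expR.
have h3 : 3 ^+ K <= e 8.
  apply: (@le_trans _ _ (expR 2 ^+ K)).
    rewrite lerXn2r ?nnegrE ?expR_ge0 //.
    by apply: le_trans (expR_ge1Dx _); lra.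
  by rewrite -expRM_natl ler_expR; move: K_le; lra.
apply: (@le_trans _ _ (expR (k%:R / 64) * (e 8 * e (-16)))).
  by rewrite ler_pM ?mulr_ge0 ?exprn_ge0 ?expR_ge0 // ler_wpM2r ?expR_ge0.
by rewrite -!expRD -[leRHS]expR0 ler_expR; move: kR; lra.
Qed.

Lemma growth_2 : (1 + 9 * e (-16)) ^+ m - 1 <= 18 * e (-3).
Proof.
have u0 : 0 <= 9 * e (-16) by rewrite mulr_ge0 ?expR_ge0.
have := exp_growth u0; set u := _ * (9 * _).
have u0' : 0 <= u by rewrite mulr_ge0.
have ue : u <= 9 * e (-15).
  rewrite /u mulrCA ler_wpM2l //; apply: (@le_trans _ _ (e 1 * e (-16))).
    by rewrite ler_wpM2r ?expR_ge0 // mul1r.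
  by rewrite -expRD -mulrDl ler_expR; lra.
have e15 : e (-15) <= 1 / 100.
  rewrite -[leRHS]invrK div1r invrK -[e _]invrK -expRN lef_pV2 ?posrE ?expR_gt0 //.
  by apply: le_trans (expR_ge1Dx _); move: kR; lra.
have e153 : e (-15) <= e (-3) by apply: e_decr; lra.
move=> h; apply: (@le_trans _ _ (2 * u)); last by lra.
rewrite lerBlDr; apply: (le_trans h).
(* This gives [expR u * (1 - u) <= 1 <= (1 + 2 * u) * (1 - u)], hence [expR u <= 1 + 2 * u]. *)
have : 1 - u <= expR (- u) by exact: expR_ge1Dx.
rewrite expRN => h2.
have /ler_pM2r h1 : 0 < 1 - u by lra.
have : expR u * (1 - u) <= 1.
  apply: (@le_trans _ _ (expR u * (expR u)^-1)); first by rewrite ler_wpM2l ?expR_ge0.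
  by rewrite divff // gt_eqF ?expR_gt0.
have : 0 <= u * (1 - 2 * u) by rewrite mulr_ge0 //; lra.
by move=> h4 h3; rewrite -h1; lra.
Qed.

Lemma lost_mass_ub (V : finType) : (#|V| <= m.+1 * d)%N ->
  lost_mass V (expR (n%:R / 64)) (e (-16)) K m <= 6 * e (-3).
Proof.
move=> VW; rewrite /lost_mass.
set B := expR (n%:R / 64); set G := (1 + _) ^+ m.
have W : #|V|%:R <= 2 * e 1 * expR (n%:R * k%:R / 4096).
  apply: (@le_trans _ _ ((m.+1)%:R * d%:R)); first by rewrite -natrM ler_nat.
  apply: ler_pM => //; rewrite -natr1 mul1r.
  have : 1 <= expR (k%:R / 64) :> R by rewrite -expR0 ler_expR divr_ge0.
  by move: m_small; lra.
have h2 : 2 ^+ K <= e 4.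
  apply: (@le_trans _ _ (expR 1 ^+ K)).
    rewrite lerXn2r ?nnegrE ?expR_ge0 //.
    by apply: le_trans (expR_ge1Dx _); lra.
  by rewrite -expRM_natl ler_expR; move: K_le; lra.
have G0 : 0 <= G by rewrite exprn_ge0 // addr_ge0 // mulr_ge0 ?exprn_ge0 ?expR_ge0.
have main : #|V|%:R * (2 * B * (2 ^+ K * G) / B ^+ K) <= 4 * e (-4).
  apply: (@le_trans _ _ (2 * e 1 * expR (n%:R * k%:R / 4096)
     * (2 * B * (e 4 * expR 1) / B ^+ K))).
    apply: ler_pM => //.
      by rewrite divr_ge0 ?mulr_ge0 ?exprn_ge0 ?expR_ge0.
    rewrite ler_wpM2r ?invr_ge0 ?exprn_ge0 ?expR_ge0 //.
    rewrite ler_wpM2l ?mulr_ge0 ?expR_ge0 //.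
    by apply: ler_pM; rewrite ?exprn_ge0 //; exact: growth_K.
  rewrite /B -expRM_natl -expRN.
  have -> : 2 * e 1 * expR (n%:R * k%:R / 4096)
     * (2 * expR (n%:R / 64) * (e 4 * expR 1) * expR (- (K%:R * (n%:R / 64))))
   = 4 * (e 1 * expR (n%:R * k%:R / 4096) * expR (n%:R / 64) * e 4 * expR 1
        * expR (- (K%:R * (n%:R / 64)))) by ring.
  rewrite ler_wpM2l // -!expRD ler_expR.
  (* The gain [B ^- K] is about [exp (-nk/1024)] and beats the vertex count [exp (nk/4096)]; the
     remaining terms, linear in [n] or [k], are absorbed using [k >= 128] and [n >= 4096]. *)
  have Kn : (k%:R / 16 - 1) * (n%:R / 64) <= K%:R * (n%:R / 64) :> R.
    by rewrite ler_wpM2r // divr_ge0.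
  have nk1 : 128 * n%:R <= k%:R * n%:R :> R.
    by rewrite ler_wpM2r //; move: kR; lra.
  have nk2 : 4096 * k%:R <= n%:R * k%:R :> R by rewrite ler_wpM2r.
  by move: kR Kn nk1 nk2; lra.
apply: (@le_trans _ _ (e 1 * (2 * e (-4) + 4 * e (-4)))); last first.
  rewrite -mulrDl mulrCA -expRD -mulrDl.
  by rewrite le_eqVlt; apply/orP; left; apply/eqP; congr (_ * expR (_ * _)); lra.
apply: ler_pM => //.
- by rewrite addr_ge0 ?mulr_ge0 ?invr_ge0 ?exprn_ge0 ?expR_ge0.
- by rewrite mul1r.
apply: lerD => //; rewrite ler_wpM2l // /B -expRN ler_expR.
by move: k_small; lra.
Qed.

Lemma success_lt (P : branching_program (sample n) m d) :
  success R k (bp_output P) < 1 / 2 + expR (- (k%:R / 128)).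
Proof.
have n0 : (0 < n)%N by exact: leq_trans n_large.
have lamE : expR (- (k%:R / 4)) = e (-16) :> R by congr expR; lra.
(* With [tau = e (-1)] the three error terms are at most 1, 96 and 6 times [e (-1)]; half their sum
   is below 53. *)
apply: le_lt_trans (success_ub P K n0 k_small (expR_gt0 _) : _ <=
  1 / 2 + (e (-1) + _ / e (-1) + _) / 2) _.
rewrite ltrD2l lamE.
have := lost_mass_ub (card_vertex P); set lost := lost_mass _ _ _ _ _ => hlost.
have hgrow := growth_2.
have e1 : e (-3) / e (-1) <= e (-1).
  by rewrite -expRN -expRD ler_expR; move: kR; lra.
have e31 : e (-3) <= e (-1) by apply: e_decr; lra.
have frac : 4 * ((1 + 9 * e (-16)) ^+ m - 1 + lost) / e (-1) <= 96 * e (-1).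
  apply: (@le_trans _ _ (96 * (e (-3) / e (-1)))); last by rewrite ler_wpM2l.
  rewrite mulrA ler_wpM2r ?invr_ge0 ?expR_ge0 //; lra.
(* As [e (-1)] is the square of [exp (-k/128)], it suffices that [53 <= 1 + k/128], whence the
   threshold [6656 = 52 * 128]. *)
have half : 53 * e (-1) <= expR (- (k%:R / 128)).
  have -> : e (-1) = expR (- (k%:R / 128)) * expR (- (k%:R / 128)).
    by rewrite -expRD; congr expR; lra.
  rewrite mulrA ler_piMl ?expR_ge0 // expRN ler_pdivrMr ?expR_gt0 // mul1r.
  by apply: le_trans (expR_ge1Dx _); move: kR; lra.
have := expR_gt0 (-1 * (k%:R / 64) : R); lra.
Qed.

End Constants.

(** * The trade-off between memory and samples *)

Theorem theorem4p3 (R : realType) :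
  exists c5 : R, 0 < c5 /\
  exists alpha beta : R, 0 < alpha /\ 0 < beta /\
  forall f : nat -> R^o, f =o_\oo (fun k : nat => k%:R : R^o) ->
  exists N : nat, forall n k : nat, (N <= n)%N ->
    c5 * log2 n%:R < k%:R -> k%:R <= n%:R / 4 :> R ->
  forall (m d : nat) (B : branching_program (sample n) m d),
    1 / 2 + 2 `^ (- f k) <= success R k (bp_output B) ->
    alpha * n%:R * k%:R <= log2 d%:R \/ 2 `^ (beta * k%:R) <= m%:R :> R.
Proof.
exists 1; split; first exact: ltr01.
exists (1 / 4096), (1 / 64); split; first lra.
split; first lra.
move=> f fo.
have ln2_gt0 : 0 < ln 2 :> R by rewrite ln_gt0 // ltr1n.
have ln2_le1 : ln 2 <= 1 :> R.
  rewrite -ler_expR lnK ?posrE //.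
  by apply: le_trans (expR_ge1Dx _); lra.
have pow2 (c : R) : 2 `^ c = expR (c * ln 2).
  by rewrite /powR pnatr_eq0.
(* The constant 1/128 makes [2 ^ (- f k)] at least the [exp (-k/128)] of [success_lt]. *)
have [k0 _ fk0] : \forall k \near \oo, `|f k| <= 1 / 128 * `|k%:R : R^o|.
  by have /eqoP := fo; apply.
pose T := maxn k0 6656.
(* Together with [log2 n < k], the bound [2 ^ T <= n] forces [k > T]. *)
exists (maxn 4096 (2 ^ T)) => n k; rewrite geq_max => /andP[n_large n_T].
rewrite mul1r => log_k k_small m d P succ.
have k_T : (T < k)%N.
  rewrite -(ltr_nat R); apply: le_lt_trans log_k.
  rewrite /log2 ler_pdivlMr // -ln_powR powR_mulrn // ler_ln ?posrE ?exprn_gt0 //.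
    by rewrite -natrX ler_nat.
  by rewrite ltr0n (leq_trans _ n_large).
have k_large : (6656 <= k)%N by rewrite (leq_trans _ (ltnW k_T)) // leq_maxr.
have k_k0 : (k0 <= k)%N by rewrite (leq_trans _ (ltnW k_T)) // leq_maxl.
(* If both alternatives fail, [success_lt] contradicts the assumed success; [ln 2 <= 1] covers the
   change from base 2 to base e. *)
have [|d_small] := leP; first by left.
have [|m_small] := leP; first by right.
have scale (c : R) : 0 <= c -> c * ln 2 <= c by move=> c0; rewrite ler_piMr.
have m_le : m%:R <= expR (k%:R / 64) :> R.
  apply: (le_trans (ltW m_small)); rewrite pow2 ler_expR.
  apply: (le_trans (scale _ _)); first by rewrite mulr_ge0.
  by rewrite mulrC mulrA mulr1.
have d_le : d%:R <= expR (n%:R * k%:R / 4096) :> R.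
  (* Width 0 is treated apart because [lnK] needs a positive argument. *)
  have [->|d_gt0] := posnP d; first exact: expR_ge0.
  move: d_small; rewrite /log2 ltr_pdivrMr // => d_small.
  rewrite -[leLHS]lnK ?posrE ?ltr0n // ler_expR; apply: (le_trans (ltW d_small)).
  apply: (le_trans (scale _ _)); last by lra.
  by apply: mulr_ge0; [apply: mulr_ge0; [lra | exact: ler0n] | exact: ler0n].
have := success_lt k_small n_large k_large m_le d_le P.
suff h : expR (- (k%:R / 128)) <= 2 `^ (- f k) by move: succ h; lra.
rewrite pow2 ler_expR mulNr lerN2.
apply: (@le_trans _ _ `|f k|).
  apply: (@le_trans _ _ (`|f k| * ln 2)); last exact: scale.
  by rewrite ler_pM2r // ler_norm.
by apply: (le_trans (fk0 k k_k0)); rewrite ger0_norm // mulrC mulrA mulr1.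
Qed.
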